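(* Let $\boldsymbol{X}\sim \mathbb{ELS}(\boldsymbol{\lambda},\boldsymbol{\theta},\boldsymbol{\alpha};F_{b})$ and $\boldsymbol{Y}\sim \mathbb{ELS}(\boldsymbol{\mu},\boldsymbol{\delta},\boldsymbol{\beta};F_{b})$ be random vectors, each with independent components, where $\boldsymbol{\lambda}=\boldsymbol{\mu}=\lambda\boldsymbol{1}_{n}$ and $\boldsymbol{\alpha}=\boldsymbol{\beta}=\alpha\boldsymbol{1}_{n}$ for scalars $\lambda,\alpha>0$. Suppose that either $\boldsymbol{\theta},\boldsymbol{\delta}\in\mathcal{E}_+$ or $\boldsymbol{\theta},\boldsymbol{\delta}\in\mathcal{D}_+$, and that $w^2\tilde{r}_{b}(w)$ is increasing in $w>0$. Then $\boldsymbol{\theta}\succeq^{w}\boldsymbol{\delta}$ implies $X_{n-1:n}\leq_{st}Y_{n-1:n}$.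
   Context: ''Increasing'' and ''decreasing'' are meant in the non-strict sense. All random variables are nonnegative and absolutely continuous. $F_b$ is a baseline cumulative distribution function with density $f_b$, and $\tilde r_b=f_b/F_b$ is its reversed hazard rate. $\boldsymbol{X}=(X_1,\dots,X_n)\sim\mathbb{ELS}(\boldsymbol\lambda,\boldsymbol\theta,\boldsymbol\alpha;F_b)$ (exponentiated location-scale model), with $\boldsymbol\lambda=(\lambda_1,\dots,\lambda_n)$, $\boldsymbol\theta=(\theta_1,\dots,\theta_n)$, $\boldsymbol\alpha=(\alpha_1,\dots,\alpha_n)$ having positive entries, means that $X_i$ has distribution function $F_{X_i}(x)=[F_b((x-\lambda_i)/\theta_i)]^{\alpha_i}$ for $x>\lambda_i$ (and $0$ for $x\le\lambda_i$), $i=1,\dots,n$. $X_{k:n}$ is the $k$th smallest of $X_1,\dots,X_n$, so $X_{n-1:n}$ is the second-largest order statistic. $\boldsymbol 1_n=(1,\dots,1)$. $\mathcal D_+=\{(x_1,\dots,x_n):x_1\ge x_2\ge\cdots\ge x_n>0\}$ and $\mathcal E_+=\{(x_1,\dots,x_n):0<x_1\le x_2\le\cdots\le x_n\}$. For vectors $\boldsymbol x,\boldsymbol y$ with increasing rearrangements $x_{1:n}\le\cdots\le x_{n:n}$ and $y_{1:n}\le\cdots\le y_{n:n}$, $\boldsymbol y\succeq^w\boldsymbol x$ ($\boldsymbol x$ is weakly supermajorized by $\boldsymbol y$) means $\sum_{i=1}^k x_{i:n}\ge\sum_{i=1}^k y_{i:n}$ for all $k=1,\dots,n$. $U\le_{st}V$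 means $P(U>x)\le P(V>x)$ for all $x$. *)

(* Defs.v *)
From HB Require Import structures.
From mathcomp Require Import all_boot all_order all_algebra.
From mathcomp Require Import all_classical all_reals all_analysis.
From mathcomp Require Import measurable_realfun.
Set Implicit Arguments.
Unset Strict Implicit.
Unset Printing Implicit Defensive.
Import Order.TTheory GRing.Theory Num.Theory.
Import numFieldNormedType.Exports.

Local Open Scope classical_set_scope.
Local Open Scope ring_scope.

Section vectors.
Context {R : realType} {n : nat}.
Implicit Types x y : 'rV[R]_n.

Definition positive_entries x := forall i, 0 < x 0 i.

Definition D_plus x :=
  positive_entries x /\ forall i j : 'I_n, (i <= j)%N -> x 0 j <= x 0 i.

Definition E_plus x :=
  positive_entries x /\ forall i j : 'I_n, (i <= j)%N -> x 0 i <= x 0 j.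

(* [kth_smallest x k] is x_{k:n}, with the rank k running from 1 to n. *)
Definition kth_smallest x (k : nat) : R :=
  nth 0 (sort <=%R [seq x 0 i | i <- enum 'I_n]) k.-1.

(* y is the majorizing vector: [weak_supermajorizes y x] is y \succeq^w x. *)
Definition weak_supermajorizes y x :=
  forall k : nat, (1 <= k <= n)%N ->
    \sum_(1 <= i < k.+1) kth_smallest x i >=
    \sum_(1 <= i < k.+1) kth_smallest y i.

End vectors.

Section baseline.
Context {R : realType}.

Definition is_density (F f : R -> R) :=
  [/\ measurable_fun [set: R] f, forall x, 0 <= f x &
      forall x, (F x)%:E = (\int[lebesgue_measure]_(t in `]-oo, x]) (f t)%:E)%E].

(* F is the distribution function of an almost surely nonnegative variable. *)
Definition nonnegative_cdf (F : R -> R) := forall x, x <= 0 -> F x = 0.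

(* By the convention a / 0 = 0 this is 0 wherever F vanishes. *)
Definition reversed_hazard_rate (F f : R -> R) (w : R) := f w / F w.

End baseline.

Section random_vectors.
Context {R : realType} {d : measure_display} {T : measurableType d}
  {P : probability T R} {n : nat}.
Implicit Type X : 'I_n -> {RV P >-> R}.

Definition mutually_independent X :=
  forall (J : {set 'I_n}) (B : 'I_n -> set R),
    (forall i, measurable (B i)) ->
    P (\bigcap_(i in [set` J]) (X i @^-1` B i)) =
    (\prod_(i in J) P (X i @^-1` B i))%E.

Definition ELS (lambda theta alpha : 'rV[R]_n) (F : R -> R) X :=
  [/\ positive_entries lambda, positive_entries theta,
      positive_entries alpha &
      forall (i : 'I_n) (x : R), cdf (X i) x =
        (if lambda 0 i < x
         then F ((x - lambda 0 i) / theta 0 i) `^ (alpha 0 i) else 0)%:E].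

Definition order_stat_fun X (k : nat) (w : T) : R :=
  kth_smallest (\row_i X i w) k.

Lemma nth_sort_le (s : seq R) (i : nat) (y : R) : (i < size s)%N ->
  (nth 0 (sort <=%R s) i <= y) = (i < count (<= y) s)%N.
Proof.
rewrite -(size_sort <=%R s) -(count_sort <=%R (<= y)).
have : sorted <=%R (sort <=%R s) by exact: sort_le_sorted.
move: (sort <=%R s) => {}s ss; elim: s ss i => [//|a s IH] /= pas i.
have ss := path_sorted pas.
have /allP as_ : all (>= a) s by exact: order_path_min le_trans pas.
have count0 : ~~ (a <= y) -> count (<= y) s = 0%N.
  move=> nay; apply/eqP; rewrite eqn0Ngt -has_count; apply/hasPn => z zs /=.
  by apply: contra nay; exact: le_trans (as_ z zs).
case: i => [_|i ilt] /=; first by case: (boolP (a <= y)) => // /count0 ->.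
by rewrite IH//; case: (boolP (a <= y)) => // /count0 ->.
Qed.

Lemma order_stat_fun_le X (k : nat) (y : R) (w : T) : (k.-1 < n)%N ->
  (order_stat_fun X k w <= y) = (k.-1 < \sum_(i < n) (X i w <= y)%R)%N.
Proof.
move=> kn; rewrite /order_stat_fun /kth_smallest nth_sort_le; last first.
  by rewrite size_map size_enum_ord.
congr (_ < _)%N; rewrite -sum1_count big_map big_mkcond/= big_enum/=.
by apply: eq_bigr => i _; rewrite mxE; case: ifP.
Qed.

Lemma measurable_order_stat_fun X k :
  measurable_fun [set: T] (order_stat_fun X k).
Proof.
have [kn|nk] := ltnP k.-1 n; last first.
  rewrite (_ : order_stat_fun X k = cst 0)//; apply/funext => w.
  rewrite /order_stat_fun /kth_smallest nth_default//.
  by rewrite size_sort size_map size_enum_ord.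
apply: (measurability _ (RGenOInfty.measurableE R)) => // _ [_ [y ->] <-].
rewrite setTI.
pose N w : R := \sum_(i < n) \1_(X i @^-1` `]-oo, y]) w.
have mN : measurable_fun [set: T] N.
  apply: measurable_sum => i; apply: measurable_indic.
  by rewrite -[X in measurable X]setTI; exact: measurable_funPT.
suff -> : order_stat_fun X k @^-1` `]y, +oo[ = N @^-1` `]-oo, k.-1%:R].
  by rewrite -[X in measurable X]setTI; exact: mN.
have NE w : N w = (\sum_(i < n) (X i w <= y)%R)%:R.
  rewrite natr_sum; apply: eq_bigr => i _; rewrite indicE; congr (_%:R).
  by congr nat_of_bool; apply/idP/idP; rewrite inE/= in_itv.
apply/seteqP; split => w /=; rewrite !in_itv/= andbT;
  by rewrite ltNge order_stat_fun_le// -leqNgt NE ler_nat.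
Qed.

HB.instance Definition _ X k :=
  isMeasurableFun.Build _ _ _ _ (order_stat_fun X k)
    (@measurable_order_stat_fun X k).

(* The order statistic X_{k:n}, for 1 <= k <= n. *)
Definition order_stat X (k : nat) : {RV P >-> R} := order_stat_fun X k.

End random_vectors.

Definition st_le (R : realType) (d d' : measure_display)
    (T : measurableType d) (T' : measurableType d')
    (P : probability T R) (Q : probability T' R)
    (U : {RV P >-> R}) (V : {RV Q >-> R}) :=
  forall x : R, (ccdf U x <= ccdf V x)%E.

(* Main.v *)
Require Import Defs.
From HB Require Import structures.
From mathcomp Require Import all_boot all_order all_algebra.
From mathcomp Require Import all_classical all_reals all_analysis.
From mathcomp Require Import measurable_realfun.
From mathcomp Require Import ring lra zify.
Set Implicit Arguments.
Unset Strict Implicit.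
Unset Printing Implicit Defensive.
Import Order.TTheory GRing.Theory Num.Theory.
Import numFieldNormedType.Exports.

Local Open Scope ring_scope.

(** Fix a point [x] above the common location and put [u = x - l]. A component
with scale [t] is at most [x] with probability [p t = F(u / t) ^ a], and the
second largest component is at most [x] exactly when at most one component
exceeds [x]. By independence its distribution function at [x] is therefore the
probability [at_most_one_failure] of having at most one failure among
independent trials with success probabilities [p theta_i]
([cdf_second_largest_gt0]). This is a symmetric function of the scales, and it
has to be larger at the supermajorizing vector.

The assumption on the reversed hazard rate [r] says that [ln p] is convex in
the scale: with [w = u / t], the derivative of [ln p] in [t] is
[- a / u * w^2 r(w)]. Since [F] need not be differentiable, convexity is
obtained in the integrated form [F(1/x) F(1/y) <= F(1/(x-D)) F(1/(y+D))] for
[x <= y] ([cdf_inv_spread]). With [c = w^2 r(w)] taken at [w = 1/x], the density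
is at least [c F(v) / v^2] above [w] and at most that below [w]; integrating
over short steps gives first-order growth bounds, and refining the subdivision
makes the accumulated second-order error vanish ([subdivided_spread]). The same
bounds keep [F] from reaching zero at a positive point ([cdf_gt0]).

Moving two scales [s <= t] apart by the same amount hence raises the product of
their [p]-values while lowering the smaller of the two, and both effects
increase the probability of at most one failure
([at_most_one_failure_spread]). Lowering a single scale increases it as well.
Finally, weak supermajorization lets one go from the majorizing vector to the
other one through finitely many steps that undo such moves
([at_most_one_failure_weak_majorization]). *)

(** * Integrals of a density *)

Section analysis.
Context {R : realType}.
Local Open Scope classical_set_scope.
Notation mu := (@lebesgue_measure R).

Lemma is_derive1_oppV (K x : R) : x != 0 ->
  is_derive x 1 (fun w => - (K / w)) (K / x ^+ 2).
Proof.
move=> x0.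
have := is_deriveZ (- K) (@is_deriveV R id x 1 1 x0 (is_derive_id _ _)).
rewrite (_ : _ *: _ = K / x ^+ 2); last first. by rewrite /GRing.scale/= mulr1 mulrN mulNr opprK.
congr is_derive; apply/funext => w /=.
by rewrite -mulNr.
Qed.

Lemma continuous_inv_sqr (K w : R) : 0 < w ->
  {for w, continuous (fun w : R => K / w ^+ 2)}.
Proof.
move=> w0; apply: cvgM; first exact: cvg_cst.
apply: cvgV; first by rewrite gt_eqF// exprn_gt0.
exact: exprn_continuous.
Qed.

Lemma measurable_inv_sqr (K a b : R) : 0 < a ->
  measurable_fun `]a, b] (fun w : R => (K / w ^+ 2)%:E).
Proof.
move=> a0.
apply/measurable_EFinP; apply: (@measurable_funS _ _ _ _ (`]0%R, +oo[%classic : set R)) => //.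
  by move=> w /=; rewrite !in_itv/= andbT => /andP[/(lt_trans a0)].
apply: open_continuous_measurable_fun => // w.
by rewrite inE/= in_itv/= andbT; exact: continuous_inv_sqr.
Qed.

Lemma integral_inv_sqr (K a b : R) : 0 < a -> a < b ->
  (\int[mu]_(w in `]a, b]) (K / w ^+ 2)%:E = (K * (a^-1 - b^-1))%:E)%E.
Proof.
move=> a0 ab.
have dF (w : R) : 0 < w -> is_derive w 1 (fun w => - (K / w)) (K / w ^+ 2).
  by move=> w0; apply: is_derive1_oppV; rewrite gt_eqF.
have cF (w : R) : 0 < w -> {for w, continuous (fun w : R => - (K / w))}.
  move=> w0; apply/differentiable_continuous/derivable1_diffP.
  exact: (@ex_derive _ _ _ _ _ _ _ (dF w w0)).
rewrite integral_itv_obnd_cbnd; last first.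
  exact: measurable_inv_sqr.
rewrite (@continuous_FTC2 _ _ (fun w => - (K / w)))//.
- by rewrite -EFinB; congr EFin; rewrite opprK addrC mulrBr.
- apply: continuous_in_subspaceT => w; rewrite inE/= in_itv/= => /andP[aw _].
  by apply: continuous_inv_sqr; apply: lt_le_trans aw.
- split.
  + by move=> w; rewrite in_itv/= => /andP[aw _]; apply: (@ex_derive _ _ _ _ _ _ _ (dF w (lt_trans a0 aw))).
  + by apply: cvg_at_right_filter; apply: cF.
  + by apply: cvg_at_left_filter; apply: cF; apply: lt_trans ab.
- move=> w; rewrite in_itv/= => /andP[aw _].
  by rewrite derive1E; apply: (@derive_val _ _ _ _ _ _ _ (dF w (lt_trans a0 aw))).
Qed.

Variables (F f : R -> R).
Hypothesis Ff : is_density F f.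

Lemma density_integral_itv a b : a <= b ->
  ((F b - F a)%:E = \int[mu]_(w in `]a, b]) (f w)%:E)%E.
Proof.
have [mf f0 FE] := Ff; move=> ab.
have := FE b; rewrite (@itv_bndbnd_setU _ _ _ (BRight a))// ge0_integral_setU//; last 3 first.
- by apply/measurable_EFinP; apply: measurable_funTS.
- by move=> x _; rewrite lee_fin.
- apply/disj_set2P; rewrite -subset0 => z/=; rewrite !in_itv/= => -[za /andP[]].
  by rewrite ltNge za.
by rewrite -FE EFinB => ->; rewrite addeAC subee ?add0e.
Qed.

Lemma density_nondecreasing a b : a <= b -> F a <= F b.
Proof.
have [_ f0 _] := Ff; move=> ab; rewrite -subr_ge0 -lee_fin density_integral_itv//.
by apply: integral_ge0 => x _; rewrite lee_fin.
Qed.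

(** Comparing with [K / w^2], whose integral is a difference of inverses, makes
the bounds linear in the reciprocal variable, that is, in the scale. *)
Lemma density_ge_inv_sqr K a b : 0 <= K -> 0 < a -> a <= b ->
  (forall w, a < w <= b -> K / w ^+ 2 <= f w) ->
  K * (a^-1 - b^-1) <= F b - F a.
Proof.
have [mf f0 FE] := Ff; move=> K0 a0; rewrite le_eqVlt => /predU1P[<-|ab] Kf.
  by rewrite !subrr mulr0.
rewrite -lee_fin density_integral_itv ?(ltW ab)// -integral_inv_sqr//.
apply: ge0_le_integral => //.
- by move=> w _; rewrite lee_fin divr_ge0// sqr_ge0.
- exact: measurable_inv_sqr.
- by apply/measurable_EFinP; apply: measurable_funTS.
Qed.

Lemma density_le_inv_sqr K a b : 0 < a -> a <= b ->
  (forall w, a < w <= b -> f w <= K / w ^+ 2) ->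
  F b - F a <= K * (a^-1 - b^-1).
Proof.
have [mf f0 FE] := Ff; move=> a0; rewrite le_eqVlt => /predU1P[<-|ab] Kf.
  by rewrite !subrr mulr0.
rewrite -lee_fin density_integral_itv ?(ltW ab)// -integral_inv_sqr//.
apply: ge0_le_integral => //.
- by move=> w _; rewrite lee_fin.
- by apply/measurable_EFinP; apply: measurable_funTS.
- exact: measurable_inv_sqr.
Qed.

(** Continuity is the absolute continuity of the integral. The density is cut
off to the right of [x + 1], where [F] itself shows that it is integrable. *)
Lemma density_continuous : continuous F.
Proof.
have [mf f0 FE] := Ff; move=> x; apply/cvgrPdist_lt => e e0.
pose D := `]-oo, x + 1]%classic : set R.
have ifD : mu.-integrable setT (EFin \o f \_ D).
  rewrite -restrict_EFin; apply/integrable_restrict; rewrite ?setTI //; first exact: measurable_itv.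
  apply/integrableP; split; first by apply/measurable_EFinP; apply: measurable_funTS.
  under eq_integral do rewrite /= ger0_norm//.
  by rewrite -FE ltry.
have [r [r0 intlt]] := integral_normr_continuous ifD e0.
suff key a b : a <= b -> b <= x + 1 -> b - a < r -> F b - F a < e.
  near=> y.
  have yx : `|x - y| < r by near: y; apply/nbhs_ballP; exists r.
  have [xy|/ltW xy] := leP x y.
    rewrite distrC ger0_norm ?subr_ge0 ?density_nondecreasing//.
    apply: key => //; last by rewrite -(ger0_norm (_ : 0 <= y - x)) ?subr_ge0// distrC.
    rewrite -lerBlDl; apply: le_trans (ler_norm _) _; rewrite distrC; apply: ltW.
    by near: y; apply/nbhs_ballP; exists 1 => //=; exact: ltr01.
  rewrite ger0_norm ?subr_ge0 ?density_nondecreasing//.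
  apply: key => //; first by rewrite lerDl.
  by rewrite -(ger0_norm (_ : 0 <= x - y)) ?subr_ge0.
move=> ab bx abr.
have /intlt : (mu `]a, b] < r%:E)%E.
  rewrite lebesgue_measure_itv/= lte_fin; case: ifP => _; rewrite ?lte_fin// -EFinB lte_fin.
move=> /(_ (measurable_itv _)); rewrite /Rintegral -lte_fin.
rewrite (_ : integral _ _ _ = (F b - F a)%:E) //.
rewrite density_integral_itv//; apply: eq_integral => w; rewrite inE/= in_itv/= => /andP[aw wb].
rewrite /D patchE ifT ?ger0_norm// inE/= in_itv/= (le_trans wb).
Unshelve. all: by end_near. Qed.

End analysis.

(** * From first-order bounds to a product inequality *)

Section subdivision.
Context {R : realType}.
Implicit Types H : R -> R.

Lemma bernoulli_sub1 (z : R) (k : nat) : 0 <= z <= 1 ->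
  1 - k%:R * z <= (1 - z) ^+ k.
Proof.
move=> /andP[z0 z1]; elim: k => [|k IH]; first by rewrite mul0r subr0 expr0.
rewrite exprS -natr1.
have k0 : (0 : R) <= k%:R by [].
have := ler_wpM2l (_ : 0 <= 1 - z) IH; rewrite subr_ge0 z1 => /(_ isT).
apply: le_trans; nra.
Qed.

Lemma iterated_growth H (c x h : R) (N : nat) : 0 <= c -> 0 <= h ->
  (forall s, x - N%:R * h <= s - h -> s <= x ->
     H s * (1 + c * h) <= H (s - h)) ->
  H x * (1 + c * h) ^+ N <= H (x - N%:R * h).
Proof.
move=> c0 h0; elim: N => [|N IH] Hs; first by rewrite expr0 mul0r mulr1 subr0.
have -> : x - N.+1%:R * h = x - N%:R * h - h by rewrite -natr1; ring.
rewrite exprSr mulrA; apply: le_trans (_ : H (x - N%:R * h) * (1 + c * h) <= _).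
  rewrite ler_wpM2r ?IH// ?addr_ge0 ?mulr_ge0// => s xs sx.
  by apply: Hs => //; rewrite -natr1; nra.
have N0 : (0 : R) <= N%:R by [].
by apply: Hs; [rewrite -natr1; nra|nra].
Qed.

Lemma iterated_decay H (c y h : R) (N : nat) : 0 <= h -> c * h <= 1 ->
  (forall s, y <= s -> s + h <= y + N%:R * h ->
     H s * (1 - c * h) <= H (s + h)) ->
  H y * (1 - c * h) ^+ N <= H (y + N%:R * h).
Proof.
move=> h0 ch; elim: N => [|N IH] Hs; first by rewrite expr0 mul0r mulr1 addr0.
have -> : y + N.+1%:R * h = y + N%:R * h + h by rewrite -natr1; ring.
rewrite exprSr mulrA; apply: le_trans (_ : H (y + N%:R * h) * (1 - c * h) <= _).
  rewrite ler_wpM2r ?IH// ?subr_ge0// => s xs sx.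
  by apply: Hs => //; rewrite -natr1; nra.
have N0 : (0 : R) <= N%:R by [].
by apply: Hs; [nra|rewrite -natr1; nra].
Qed.

(** The two one-step bounds share the slope [c], so that, over [N] steps of
length [h = D / N], the product of the growth and decay factors is
[(1 - (c h)^2)^N]. By Bernoulli's inequality this is at least
[1 - (c D)^2 / N], which tends to 1. *)
Lemma subdivided_spread H (c x y D : R) : 0 <= c -> 0 <= D ->
  (forall s, x - D <= s -> 0 <= H s) ->  x <= y ->
  (forall s h, 0 <= h -> x - D <= s - h -> s <= x ->
     H s * (1 + c * h) <= H (s - h)) ->
  (forall s h, 0 <= h -> y <= s -> s + h <= y + D ->
     H s * (1 - c * h) <= H (s + h)) ->
  H x * H y <= H (x - D) * H (y + D).
Proof.
move=> c0 D0 H0 xy up down; rewrite leNgt; apply/negP => lt.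
have Hx0 : 0 <= H x by apply: H0; lra.
have Hy0 : 0 <= H y by apply: H0; lra.
set Q := H x * H y in lt *; set P := H (x - D) * H (y + D) in lt *.
have Q0 : 0 <= Q by exact: mulr_ge0.
have e0 : 0 < Q - P by rewrite subr_gt0.
(* The first bound on [N] gives [c * h <= 1], the second one makes the total
   error smaller than the gap [Q - P]. *)
pose B := Num.max (c * D) (Q * (c * D) ^+ 2 / (Q - P)).
pose N := (Num.trunc B).+1.
have BN : B < N%:R by exact: truncnS_gt.
have N0 : (0 : R) < N%:R by rewrite ltr0n.
have cDN : c * D < N%:R by apply: le_lt_trans BN; rewrite le_max lexx.
have QN : Q * (c * D) ^+ 2 < N%:R * (Q - P).
  by rewrite -ltr_pdivrMr//; apply: le_lt_trans BN; rewrite le_max lexx orbT.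
pose h := D / N%:R.
have h0 : 0 <= h by rewrite divr_ge0// ltW.
have Nh : N%:R * h = D by rewrite mulrC divfK// gt_eqF.
have ch0 : 0 <= c * h by exact: mulr_ge0.
have ch1 : c * h <= 1 by rewrite mulrA ler_pdivrMr// mul1r ltW.
have gr : H x * (1 + c * h) ^+ N <= H (x - D).
  by rewrite -Nh; apply: iterated_growth => // s; rewrite Nh => xs sx; exact: up.
have dc : H y * (1 - c * h) ^+ N <= H (y + D).
  by rewrite -Nh; apply: iterated_decay => // s; rewrite Nh => ys sy; exact: down.
have : Q * (1 - (c * h) ^+ 2) ^+ N <= P.
  have -> : 1 - (c * h) ^+ 2 = (1 + c * h) * (1 - c * h) by ring.
  rewrite exprMn mulrACA; apply: ler_pM => //.
    by rewrite mulr_ge0// exprn_ge0// addr_ge0.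
  by rewrite mulr_ge0// exprn_ge0// subr_ge0.
apply/negP; rewrite -ltNge; apply: lt_le_trans (_ : Q * (1 - N%:R * (c * h) ^+ 2) <= _).
  have -> : N%:R * (c * h) ^+ 2 = (c * D) ^+ 2 / N%:R.
    by rewrite -Nh; field; rewrite gt_eqF.
  rewrite mulrBr mulr1 mulrA ltrBrDl -ltrBrDr ltr_pdivrMr//.
  by rewrite [ltRHS]mulrC.
apply: ler_wpM2l => //; apply: bernoulli_sub1.
by rewrite sqr_ge0 expr_le1.
Qed.

End subdivision.

(** * Log-convexity of the baseline in the scale *)

Section log_convexity.
Context {R : realType}.
Variables (F f : R -> R).
Hypothesis Ff : is_density F f.
Hypothesis rhr_incr : forall v w : R, 0 < v -> v <= w ->
  v ^+ 2 * reversed_hazard_rate F f v <= w ^+ 2 * reversed_hazard_rate F f w.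

Let slope (m : R) := m ^+ 2 * reversed_hazard_rate F f m.

Lemma density_cdf_ge0 x : 0 <= F x.
Proof.
have [_ f0 FE] := Ff; rewrite -lee_fin FE.
by apply: integral_ge0 => w _; rewrite lee_fin.
Qed.

Lemma scaled_rhr_ge0 m : 0 <= slope m.
Proof.
have [_ f0 _] := Ff.
by rewrite mulr_ge0 ?sqr_ge0// divr_ge0// density_cdf_ge0.
Qed.

Lemma density_scaled_rhr w : 0 < w -> 0 < F w -> f w = slope w * F w / w ^+ 2.
Proof.
move=> w0 Fw; rewrite /slope /reversed_hazard_rate; field.
by rewrite !gt_eqF.
Qed.

(** Above [m] the density is at least [slope m * F a / w^2]: the scaled reversed
hazard rate has increased and so has [F]. *)
Lemma cdf_growth m a b : 0 < m -> m <= a -> a <= b -> 0 < F a ->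
  F a * (1 + slope m * (a^-1 - b^-1)) <= F b.
Proof.
move=> m0 ma ab Fa; rewrite mulrDr mulr1 -lerBrDl mulrA.
have a0 := lt_le_trans m0 ma.
apply: (density_ge_inv_sqr Ff) => //.
  by rewrite mulr_ge0 ?scaled_rhr_ge0 ?density_cdf_ge0.
move=> w /andP[/ltW aw _].
have w0 := lt_le_trans a0 aw.
have Faw := density_nondecreasing Ff aw.
rewrite density_scaled_rhr ?(lt_le_trans Fa Faw)//.
rewrite ler_wpM2r ?invr_ge0 ?sqr_ge0// [leRHS]mulrC; apply: ler_pM => //.
- exact: density_cdf_ge0.
- exact: scaled_rhr_ge0.
- exact: rhr_incr (le_trans ma aw).
Qed.

(** Below [m] the comparison is reversed. The condition [0 < F a] is what
identifies the density with [slope w * F w / w^2]: where [F] vanishes, the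
convention [y / 0 = 0] makes the reversed hazard rate say nothing about [f]. *)
Lemma cdf_decay m a b : 0 < a -> a <= b -> b <= m -> 0 < F a ->
  F b * (1 - slope m * (a^-1 - b^-1)) <= F a.
Proof.
move=> a0 ab bm Fa; rewrite mulrBr mulr1 lerBlDr -lerBlDl mulrA.
apply: (density_le_inv_sqr Ff) => //.
move=> w /andP[/ltW aw wb].
have w0 := lt_le_trans a0 aw.
rewrite density_scaled_rhr ?(lt_le_trans Fa (density_nondecreasing Ff aw))//.
rewrite ler_wpM2r ?invr_ge0 ?sqr_ge0// [leRHS]mulrC; apply: ler_pM => //.
- exact: scaled_rhr_ge0.
- exact: density_cdf_ge0.
- exact: rhr_incr (le_trans wb bm).
- exact: (density_nondecreasing Ff wb).
Qed.

(** A reversed hazard rate bounded by [slope M / w^2] cannot bring [F] down to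
zero at a positive point: over a step of length [h] in the reciprocal variable
[F] at most halves, whereas a continuous [F] that reached zero within such a
step would on the way take a quarter of its initial value. Finitely many steps
lead from [M] to any positive point. *)
Lemma cdf_gt0 w M : 0 < w -> 0 < M -> 0 < F M -> 0 < F w.
Proof.
move=> w0 M0 FM.
have c0 := scaled_rhr_ge0 M.
pose h := (2 * (slope M + 1))^-1.
have h0 : 0 < h by rewrite invr_gt0; lra.
have ch : slope M * h <= 2^-1 by rewrite ler_pdivrMr; lra.
have step a b : 0 < a -> a <= b -> b <= M -> a^-1 - b^-1 <= h -> 0 < F b -> 0 < F a.
  move=> a0 ab bM abh Fb; rewrite lt0r density_cdf_ge0 andbT; apply/eqP => Fa.
  have [a' + Fa'] : exists2 a', a' \in `[a, b] & F a' = F b / 4.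
    apply: IVT => //.
      by apply: continuous_subspaceT; exact: density_continuous Ff.
    by rewrite Fa ge_min le_max; apply/andP; split; apply/orP; [left|right]; lra.
  rewrite in_itv/= => /andP[aa' a'b].
  have a'0 : 0 < a' by exact: lt_le_trans aa'.
  have := @cdf_decay M a' b a'0 a'b bM.
  rewrite Fa' => /(_ ltac:(lra)).
  have : slope M * (a'^-1 - b^-1) <= 2^-1.
    apply: le_trans ch; apply: ler_wpM2l => //; apply: le_trans abh.
    by rewrite lerB// lef_pV2.
  nra.
have chain k a : 0 < a -> a^-1 <= M^-1 + k%:R * h -> 0 < F a.
  elim: k a => [|k IH] a a0 ak.
    apply: lt_le_trans FM _; apply: (density_nondecreasing Ff).
    by move: ak; rewrite mul0r addr0 lef_pV2.
  have [Ma|aM] := leP M a.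
    by apply: lt_le_trans FM _; apply: (density_nondecreasing Ff).
  pose t := Num.max (a^-1 - h) M^-1.
  have tM : M^-1 <= t by rewrite le_max lexx orbT.
  have t0 : 0 < t by apply: lt_le_trans tM; rewrite invr_gt0.
  apply: (step a t^-1) => //.
  - rewrite -lef_pV2 ?posrE ?invr_gt0// invrK ge_max lef_pV2 ?posrE// (ltW aM) andbT.
    by lra.
  - by rewrite -lef_pV2 ?posrE ?invr_gt0// invrK.
  - by rewrite invrK lerBlDr -lerBlDl le_max lexx.
  - apply: IH; first by rewrite invr_gt0.
    have k0 : (0 : R) <= k%:R by [].
    rewrite invrK ge_max; apply/andP; split; first by move: ak; rewrite -natr1; lra.
    by rewrite lerDl mulr_ge0// ltW.
apply: (chain (Num.trunc (w^-1 / h)).+1) => //.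
have : w^-1 / h < (Num.trunc (w^-1 / h)).+1%:R by exact: truncnS_gt.
rewrite ltr_pdivrMr// => /ltW /le_trans; apply.
by rewrite lerDr invr_ge0 ltW.
Qed.

(** This is log-convexity of [t |-> F (1 / t)]. The point [1 / x] serves as the
common reference for both bounds, which gives them the same slope. *)
Lemma cdf_inv_spread : (forall w, 0 < w -> 0 < F w) ->
  forall x y D, 0 <= D -> 0 < x - D -> x <= y ->
  F x^-1 * F y^-1 <= F (x - D)^-1 * F (y + D)^-1.
Proof.
move=> F0 x y D D0 xD xy.
have x0 : 0 < x by lra.
have cV s : 0 < s -> s <= x -> x^-1 <= s^-1 by move=> s0 sx; rewrite lef_pV2.
apply: (@subdivided_spread _ (fun t => F t^-1) (slope x^-1)) => //.
- exact: scaled_rhr_ge0.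
- by move=> s _; exact: density_cdf_ge0.
- move=> s h h0 xs sx.
  have s0 : 0 < s by lra.
  have sh0 : 0 < s - h by lra.
  have := @cdf_growth x^-1 s^-1 (s - h)^-1.
  rewrite !invrK !lef_pV2 ?posrE// invr_gt0 => /(_ x0 sx).
  have -> : s - (s - h) = h by ring.
  by apply; [lra|apply: F0; rewrite invr_gt0].
- move=> s h h0 ys sy.
  have s0 : 0 < s by lra.
  have sh0 : 0 < s + h by lra.
  have := @cdf_decay x^-1 (s + h)^-1 s^-1.
  rewrite !invrK !lef_pV2 ?posrE// invr_gt0 => /(_ sh0).
  have -> : s + h - s = h by ring.
  by apply; [lra|lra|apply: F0; rewrite invr_gt0].
Qed.

End log_convexity.

(** * The probability of at most one failure *)

Section at_most_one_failure.
Context {R : realType} {n : nat}.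
Implicit Types v : 'I_n -> R.

(** The probability that at most one of independent trials with success
probabilities [v i] fails: the product is the probability of no failure, and
each summand is the odds of failure of one trial. Writing it with odds
exhibits the symmetry and isolates the dependence on one or two trials. *)
Definition at_most_one_failure v :=
  (\prod_i v i) * (1 + \sum_i ((v i)^-1 - 1)).

Definition probability_weights v := forall i, 0 < v i <= 1.

Lemma odds_ge0 v i : probability_weights v -> 0 <= (v i)^-1 - 1.
Proof. by move=> /(_ i) /andP[v0 v1]; rewrite subr_ge0 invf_ge1. Qed.

(** As a function of one success probability, it is affine, and its slope is
the probability that exactly one of the other trials fails. *)
Lemma at_most_one_failure_mono1 v v' (i : 'I_n) :
  probability_weights v -> probability_weights v' ->
  (forall k, k != i -> v k = v' k) -> v i <= v' i ->
  at_most_one_failure v <= at_most_one_failure v'.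
Proof.
move=> pv pv' vv' vi; rewrite /at_most_one_failure !(bigD1 (P := xpredT) i)//=.
have -> : \prod_(k | k != i) v k = \prod_(k | k != i) v' k by exact: eq_bigr.
have -> : \sum_(k | k != i) ((v k)^-1 - 1) = \sum_(k | k != i) ((v' k)^-1 - 1).
  by apply: eq_bigr => k /vv' ->.
set A := \prod_(k | _) _; set B := \sum_(k | _) _.
have A0 : 0 <= A by apply: prodr_ge0 => k _; have /andP[/ltW] := pv' k.
have B0 : 0 <= B by apply: sumr_ge0 => k _; exact: odds_ge0.
have /andP[vi0 _] := pv i; have /andP[vi'0 _] := pv' i.
have E x : 0 < x -> x * A * (1 + (x^-1 - 1 + B)) = A * (1 + B * x).
  by move=> x0; field; rewrite gt_eqF.
by rewrite !E// ler_wpM2l// lerD2l ler_wpM2l.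
Qed.

(** As a function of two success probabilities [x] and [y], it is a combination
with nonnegative coefficients of [x + y - x * y] and [x * y]. A larger product
and a [y] that is further reduced below [x] also increase [x + y - x * y]: at a
constant product the sum grows with the gap between the two factors, and a
further increase of [x] can only help. *)
Lemma at_most_one_failure_spread v v' (i j : 'I_n) :
  probability_weights v -> probability_weights v' ->
  j != i -> (forall k, k != i -> k != j -> v k = v' k) ->
  v j <= v i -> v' j <= v j -> v i * v j <= v' i * v' j ->
  at_most_one_failure v <= at_most_one_failure v'.
Proof.
move=> pv pv' ji vv' vji v'j vij; rewrite /at_most_one_failure.
rewrite !(bigD1 (P := xpredT) i)//= !(bigD1 (P := fun k => k != i) j)//=.
have -> : \prod_(k | (k != i) && (k != j)) v k =
    \prod_(k | (k != i) && (k != j)) v' k.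
  by apply: eq_bigr => k /andP[]; exact: vv'.
have -> : \sum_(k | (k != i) && (k != j)) ((v k)^-1 - 1) =
    \sum_(k | (k != i) && (k != j)) ((v' k)^-1 - 1).
  by apply: eq_bigr => k /andP[ki kj]; rewrite vv'.
set A := \prod_(k | _) _; set B := \sum_(k | _) _.
have A0 : 0 <= A by apply: prodr_ge0 => k _; have /andP[/ltW] := pv' k.
have B0 : 0 <= B by apply: sumr_ge0 => k _; exact: odds_ge0.
have /andP[p0 _] := pv i; have /andP[p'0 _] := pv' i.
have /andP[s0 _] := pv j; have /andP[s'0 s'1] := pv' j.
have E x y : 0 < x -> 0 < y -> x * (y * A) * (1 + (x^-1 - 1 + (y^-1 - 1 + B))) =
    A * ((x + y - x * y) + B * (x * y)).
  by move=> x0 y0; field; rewrite !gt_eqF.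
rewrite !E// ler_wpM2l// lerD ?ler_wpM2l// -subr_ge0 -(pmulr_lge0 _ s'0).
rewrite [X in 0 <= X](_ : _ = (1 - v' j) * (v' i * v' j - v i * v j)
    + (v i - v' j) * (v j - v' j)); last by ring.
by rewrite addr_ge0// mulr_ge0// subr_ge0// (le_trans v'j).
Qed.

End at_most_one_failure.

(** * Weak supermajorization *)

Section weak_majorization.
Context {R : realType} {n : nat}.
Variable p : R -> R.
Hypothesis p01 : forall t, 0 < t -> 0 < p t <= 1.
Hypothesis p_noninc : forall s t, 0 < s -> s <= t -> p t <= p s.
Hypothesis p_spread : forall x y D, 0 <= D -> 0 < x - D -> x <= y ->
  p x * p y <= p (x - D) * p (y + D).

(** Induction on the number of places where [theta] and [delta] differ. If
[theta] lies below [delta], one entry is raised to its target. Otherwise let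
[j] be the first place where [theta] exceeds [delta]; the partial sum up to [j]
forces some [i] before [j] where it falls short. Moving the smaller of the two
deviations from [theta j] to [theta i] settles one of these places, and it
preserves the inequalities between partial sums because [theta] lies below
[delta] before [j]. Since [delta] is increasing, [theta i] stays below
[theta j], so that undoing the move is a spread. *)
Lemma at_most_one_failure_weak_majorization (theta delta : 'I_n -> R) :
  (forall i, 0 < theta i) -> (forall i j : 'I_n, (i <= j)%N -> delta i <= delta j) ->
  (forall i, 0 < delta i) ->
  (forall m, \sum_(k < n | (k < m)%N) theta k <= \sum_(k < n | (k < m)%N) delta k) ->
  at_most_one_failure (p \o delta) <= at_most_one_failure (p \o theta).
Proof.
move=> + delta_incr delta0.
have [N] := ubnP #|[set k | theta k != delta k]|.
elim: N theta => // N IH theta; rewrite ltnS => cardN theta0 major.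
have pw t : (forall i, 0 < t i) -> probability_weights (p \o t :> 'I_n -> R).
  by move=> t0 i; exact: p01.
have fewer (theta' : 'I_n -> R) l :
    (forall k, theta k = delta k -> theta' k = delta k) ->
    theta l != delta l -> theta' l = delta l ->
    (#|[set k | theta' k != delta k]| < N)%N.
  move=> keep ln le; apply: leq_trans cardN; apply: proper_card; apply/properP; split.
    by apply/fintype.subsetP => k; rewrite !inE; apply: contraNneq => /keep ->.
  by exists l; rewrite !inE ?le ?eqxx.
have [/existsP[j0 jP]|] := boolP [exists j, delta j < theta j]; last first.
  rewrite negb_exists => /forallP le; have {}le k : theta k <= delta k by rewrite leNgt.
  have [/existsP[i ni]|] := boolP [exists i, theta i != delta i]; last first.
    rewrite negb_exists => /forallP eq; rewrite (_ : theta = delta)//.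
    by apply/funext => k; apply/eqP; have := eq k; rewrite negbK.
  have lti : theta i < delta i by rewrite lt_neqAle ni le.
  pose theta' k := if k == i then delta i else theta k.
  have theta'0 k : 0 < theta' k by rewrite /theta'; case: ifP.
  apply: le_trans (IH theta' _ theta'0 _) _.
  - apply: (fewer _ i); rewrite /theta' ?eqxx ?lt_eqF// => k.
    by case: eqP => // ->.
  - by move=> m; apply: ler_sum => k _; rewrite /theta'; case: eqP => // ->.
  - apply: (@at_most_one_failure_mono1 _ _ _ _ i); [exact: pw|exact: pw| |].
      by move=> k ki; rewrite /= /theta' (negbTE ki).
    by rewrite /= /theta' eqxx; apply: p_noninc => //; exact: ltW.
have [{jP}j jP jmin] := arg_minnP (fun j : 'I_n => (j : nat)) (jP : (fun j => delta j < theta j) j0).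
have le (k : 'I_n) : (k < j)%N -> theta k <= delta k.
  by move=> kj; rewrite leNgt; apply/negP => /jmin; rewrite leqNgt kj.
have [i ij lti] : exists2 i : 'I_n, (i < j)%N & theta i < delta i.
  apply: contrapT => no; have := major j.+1; apply/negP; rewrite -ltNge.
  rewrite !(bigD1 (P := fun k : 'I_n => (k < j.+1)%N) j)//=.
  apply: ltr_leD => //; apply: ler_sum => k; rewrite ltnS -(inj_eq val_inj) => /andP[kj jk].
  rewrite leNgt; apply/negP => ltk; apply: no; exists k => //.
  by rewrite ltn_neqAle jk.
pose e := Num.min (delta i - theta i) (theta j - delta j).
have e0 : 0 < e by rewrite lt_min !subr_gt0 lti.
have ei : theta i + e <= delta i by rewrite -lerBrDl ge_min lexx.
have ej : delta j <= theta j - e by rewrite lerBrDl -lerBrDr ge_min lexx orbT.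
have jni : j != i by rewrite neq_ltn ij orbT.
pose theta' k := theta k + (if k == i then e else 0) - (if k == j then e else 0).
have theta'i : theta' i = theta i + e by rewrite /theta' eqxx [i == j]eq_sym (negbTE jni) subr0.
have theta'j : theta' j = theta j - e by rewrite /theta' eqxx (negbTE jni) addr0.
have theta'k k : k != i -> k != j -> theta' k = theta k.
  by move=> /negbTE ki /negbTE kj; rewrite /theta' ki kj addr0 subr0.
have theta'0 k : 0 < theta' k.
  have [->|ki] := eqVneq k i; first by rewrite theta'i addr_gt0.
  have [->|kj] := eqVneq k j; first by rewrite theta'j (lt_le_trans _ ej).
  by rewrite theta'k.
apply: le_trans (IH theta' _ theta'0 _) _.
- have keep k : theta k = delta k -> theta' k = delta k.
    have [->|ki] := eqVneq k i; first by move=> E; move: lti; rewrite E ltxx.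
    have [->|kj] := eqVneq k j; first by move=> E; move: jP; rewrite E ltxx.
    by rewrite theta'k.
  have [E|E] : e = delta i - theta i \/ e = theta j - delta j.
    by rewrite /e; case: leP; [left|right].
    by apply: (fewer _ i keep); rewrite ?lt_eqF// theta'i E addrC subrK.
  by apply: (fewer _ j keep); rewrite ?gt_eqF// theta'j E subKr.
- move=> m; have [jm|mj] := ltnP j m.
    rewrite /theta' sumrB big_split/= -!big_mkcondr/=.
    have pick1 (l : 'I_n) : (l < m)%N -> \sum_(k < n | (k < m)%N && (k == l)) e = e.
      by move=> lm; apply: big_pred1 => k /=; rewrite andb_idl// => /eqP ->.
    by rewrite !pick1 ?addrK// (ltn_trans ij).
  apply: ler_sum => k km; have kj := leq_trans km mj.
  have [->|ki] := eqVneq k i; first by rewrite theta'i.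
  by rewrite theta'k ?le// neq_ltn kj.
- apply: (@at_most_one_failure_spread _ _ _ _ i j) => //=; [exact: pw|exact: pw| | | |].
  + by move=> k ki kj; rewrite /= theta'k.
  + rewrite theta'i theta'j; apply: p_noninc; first by rewrite addr_gt0.
    by apply: le_trans ei (le_trans _ ej); apply: delta_incr; exact: ltnW.
  + by rewrite theta'j; apply: p_noninc; rewrite ?(lt_le_trans _ ej)// gerBl ltW.
  + rewrite theta'i theta'j.
    have := @p_spread (theta i + e) (theta j - e) e (ltW e0).
    rewrite addrK subrK; apply => //.
    by apply: le_trans ei (le_trans _ ej); apply: delta_incr; exact: ltnW.
Qed.

End weak_majorization.

(** * The distribution function of the second largest variable *)

Section cdf_second_largest.
Context {R : realType} {d : measure_display} {T : measurableType d}
  {P : probability T R} {n : nat}.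
Variable X : 'I_n -> {RV P >-> R}.
Local Open Scope classical_set_scope.

(** The event that the second largest variable is at most [x] splits into the
event that no variable exceeds [x] (index [None]) and, for each [i], the event
that the [i]th one alone does (index [Some i]). Each of them is a product
event. *)
Let side (x : R) (o : option 'I_n) (j : 'I_n) : set R :=
  if o == Some j then `]x, +oo[ else `]-oo, x].

Let scenario x o := \bigcap_(j in [set: 'I_n]) (X j @^-1` side x o j).

Let measurable_side x o j : measurable (side x o j).
Proof. by rewrite /side; case: ifP. Qed.

Let measurable_scenario x o : measurable (scenario x o).
Proof.
apply: fin_bigcap_measurable; first exact: finite_finset.
by move=> j _; exact: measurable_funPTI.
Qed.

Let sideE x o j w : side x o j (X j w) <-> (X j w <= x) = (o != Some j).
Proof.
rewrite /side; case: eqP => _ /=; rewrite in_itv/= ?andbT.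
  by rewrite ltNge; split => [/negbTE|->].
by [].
Qed.

Let scenarioE x o w : scenario x o w <-> forall j, (X j w <= x) = (o != Some j).
Proof.
split=> [Ew j|Ew j _]; last exact/sideE.
by apply/sideE; apply: Ew.
Qed.

Let trivIset_scenario x : trivIset setT (scenario x).
Proof.
move=> o o' _ _ [w [/scenarioE Ew /scenarioE Ew']].
have eqo j : (o == Some j) = (o' == Some j).
  by apply: negb_inj; rewrite -Ew -Ew'.
case: o eqo {Ew Ew'} => [i|]; first by move=> /(_ i); rewrite eqxx => /esym/eqP.
by case: o' => // i /(_ i); rewrite eqxx.
Qed.

Let order_stat_scenario x : (2 <= n)%N ->
  order_stat X n.-1 @^-1` `]-oo, x] = \bigcup_o scenario x o.
Proof.
move=> n2; have n0 : (n.-1.-1 < n)%N by lia.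
apply/seteqP; split => w /=; rewrite in_itv/= order_stat_fun_le//.
all: pose A := [set i | X i w <= x]%SET.
all: have -> : (\sum_(i < n) (X i w <= x)%R = #|A|)%N
       by rewrite -sum1_card [RHS]big_mkcond; apply: eq_bigr => i _; rewrite inE; case: ifP.
all: have := cardsC A; rewrite card_ord => cA.
- move=> A2; have /card_le1_eqP C1 : (#|~: A| <= 1)%N by lia.
  have [/existsP[i Xi]|/existsPn all_le] := boolP [exists i, ~~ (X i w <= x)].
    exists (Some i) => //; apply/scenarioE => j; rewrite (inj_eq Some_inj).
    apply/idP/idP => [Xj|]; first by apply: contraNneq Xi => ->.
    by apply: contraNT => Xj; apply/eqP/C1; rewrite !inE.
  by exists None => //; apply/scenarioE => j; have := all_le j; rewrite negbK.
- move=> [q _ /scenarioE Ew].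
  suff : (#|~: A| <= 1)%N by lia.
  by apply/card_le1_eqP => i j; rewrite !inE !Ew !negbK => /eqP -> /eqP[].
Qed.

(** This form of the probability also makes sense when some [p i] is zero, as it
happens at and below the location parameter. *)
Lemma cdf_second_largest (p : 'I_n -> R) x : (2 <= n)%N -> mutually_independent X ->
  (forall i, cdf (X i) x = (p i)%:E) ->
  cdf (order_stat X n.-1) x =
  (\prod_i p i + \sum_i (1 - p i) * \prod_(j | j != i) p j)%:E.
Proof.
move=> n2 indep Xp; rewrite /cdf /distribution /pushforward order_stat_scenario//.
pose r : seq (option 'I_n) := None :: map Some (enum 'I_n).
have mem_r q : q \in r by case: q => // i; rewrite inE/= mem_map ?mem_enum// => ? ? [].
have rT : [set: option 'I_n] = [set` r] by apply/seteqP; split => q _ /=.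
have P_scenario q : P (scenario x q) =
    (\prod_j (if q == Some j then 1 - p j else p j))%:E.
  have := indep finset.setT (side x q) (fun j => measurable_side x q j).
  rewrite (_ : \bigcap_(_ in _) _ = scenario x q); last first.
    by rewrite /scenario; congr bigcap; apply/seteqP; split => j //= _; rewrite inE.
  move=> ->; rewrite -prodEFin; apply: eq_big => [j|j _]; first by rewrite inE.
  rewrite /side; case: eqP => _; last exact: Xp.
  by have := ccdf_1_cdf (X j) x; rewrite Xp.
rewrite measure_fin_bigcup//; last first.
  by rewrite rT; exact: finite_seq.
rewrite rT -fsbig_seq//=; last first.
  rewrite map_inj_uniq ?enum_uniq ?andbT; last by move=> ? ? [].
  by apply/mapP => -[].
rewrite big_cons big_map big_enum/= P_scenario EFinD; congr (_ + _)%E.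
rewrite -sumEFin; apply: eq_bigr => i _; rewrite P_scenario; congr EFin.
rewrite (bigD1 i)//= eqxx; congr (_ * _).
by apply: eq_bigr => j ji; rewrite (inj_eq Some_inj) eq_sym (negbTE ji).
Qed.

Corollary cdf_second_largest_gt0 (p : 'I_n -> R) x : (2 <= n)%N ->
  mutually_independent X -> (forall i, 0 < p i) ->
  (forall i, cdf (X i) x = (p i)%:E) ->
  cdf (order_stat X n.-1) x = (at_most_one_failure p)%:E.
Proof.
move=> n2 indep p0 Xp; rewrite (cdf_second_largest n2 indep Xp); congr EFin.
rewrite /at_most_one_failure mulrDr mulr1 mulr_sumr; congr (_ + _).
apply: eq_bigr => i _; rewrite (bigD1 (P := xpredT) i)//=.
by field; rewrite gt_eqF.
Qed.

End cdf_second_largest.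

(** * Increasing rearrangements *)

Section order_statistics_of_parameters.
Context {R : realType} {n : nat}.
Implicit Types x : 'rV[R]_n.

Definition increasing_rearrangement x (k : 'I_n) : R := kth_smallest x k.+1.

Let size_sorted x : size (sort <=%R [seq x 0 i | i <- enum 'I_n]) = n.
Proof. by rewrite size_sort size_map size_enum_ord. Qed.

Lemma big_increasing_rearrangement (S : Type) (idx : S) (op : Monoid.com_law idx)
    (g : R -> S) x :
  \big[op/idx]_(i < n) g (x 0 i) =
  \big[op/idx]_(k < n) g (increasing_rearrangement x k).
Proof.
rewrite -big_enum/= -(big_map (fun i => x 0 i) xpredT g).
rewrite (perm_big (sort <=%R [seq x 0 i | i <- enum 'I_n]))/=; last first.
  by rewrite perm_sym perm_sort.
by rewrite (big_nth 0) size_sorted big_mkord.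
Qed.

Lemma at_most_one_failure_rearrangement (p : R -> R) x :
  at_most_one_failure (fun i => p (x 0 i)) =
  at_most_one_failure (p \o increasing_rearrangement x).
Proof.
rewrite /at_most_one_failure (big_increasing_rearrangement *%R p).
by rewrite (big_increasing_rearrangement +%R (fun t => (p t)^-1 - 1)).
Qed.

Lemma increasing_rearrangement_gt0 x k :
  positive_entries x -> 0 < increasing_rearrangement x k.
Proof.
move=> x0; rewrite /increasing_rearrangement /kth_smallest/=.
have : nth 0 (sort <=%R [seq x 0 i | i <- enum 'I_n]) k
    \in sort <=%R [seq x 0 i | i <- enum 'I_n] by rewrite mem_nth ?size_sorted.
by rewrite mem_sort => /mapP[i _ ->].
Qed.

Lemma increasing_rearrangement_incr x (i j : 'I_n) : (i <= j)%N ->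
  increasing_rearrangement x i <= increasing_rearrangement x j.
Proof.
move=> ij; apply: (sorted_leq_nth le_trans le_refl) => //; rewrite ?inE ?size_sorted ?ltn_ord//.
exact: sort_le_sorted.
Qed.

Lemma weak_supermajorizes_partial_sums y x m : weak_supermajorizes y x ->
  \sum_(k < n | (k < m)%N) increasing_rearrangement y k <=
  \sum_(k < n | (k < m)%N) increasing_rearrangement x k.
Proof.
move=> yx.
have E z m' : (m' <= n)%N -> \sum_(k < n | (k < m')%N) increasing_rearrangement z k =
    \sum_(1 <= i < m'.+1) kth_smallest z i.
  move=> mn; rewrite big_add1 big_mkord.
  by rewrite (big_ord_widen n (fun k => kth_smallest z k.+1) mn).
have cap z : \sum_(k < n | (k < m)%N) increasing_rearrangement z k =
    \sum_(k < n | (k < minn m n)%N) increasing_rearrangement z k.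
  by apply: eq_bigl => k; rewrite leq_min ltn_ord andbT.
rewrite !cap !E ?geq_minr//; case: (posnP (minn m n)) => [->|mn0].
  by rewrite !big_geq.
by apply: yx; rewrite mn0 geq_minr.
Qed.

End order_statistics_of_parameters.

(** * Bounds on distribution functions *)

Section cumulative_bounds.
Context {R : realType}.
Variable F : cumulativeBounded (0 : R) (1 : R).

Lemma cumulative_le1 x : F x <= 1.
Proof.
rewrite leNgt; apply/negP => F1.
have : \forall y \near +oo, F y < F x by exact: (cvgr_lt _ (cumulativey F)).
move=> near_lt; have [y [xy]] : exists y, x <= y /\ F y < F x.
  near (pinfty_nbhs R) => y; exists y; split; near: y => //.
  by apply: nbhs_pinfty_ge; rewrite num_real.
by rewrite ltNge cumulative_is_nondecreasing.
Unshelve. all: by end_near. Qed.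

Lemma cumulative_eventually_gt0 : exists2 M, 0 < M & 0 < F M.
Proof.
near (pinfty_nbhs R) => y; exists y; near: y.
  by apply: nbhs_pinfty_gt; rewrite num_real.
exact: (cvgr_gt _ (cumulativey F)).
Unshelve. all: by end_near. Qed.

End cumulative_bounds.

(** * Stochastic comparison of the second largest order statistics *)

Theorem theorem3p1 (R : realType) (n : nat) (hn : (2 <= n)%N)
  (d d' : measure_display) (T : measurableType d) (T' : measurableType d')
  (P : probability T R) (Q : probability T' R)
  (X : 'I_n -> {RV P >-> R}) (Y : 'I_n -> {RV Q >-> R})
  (Fb : cumulativeBounded (0 : R) (1 : R)) (fb : R -> R)
  (Fb_ge0 : nonnegative_cdf Fb) (Fb_fb : is_density Fb fb)
  (lambda theta alpha mu delta beta : 'rV[R]_n)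
  (X_ELS : ELS lambda theta alpha Fb X)
  (Y_ELS : ELS mu delta beta Fb Y)
  (X_indep : mutually_independent X)
  (Y_indep : mutually_independent Y)
  (l a : R) (l_gt0 : 0 < l) (a_gt0 : 0 < a)
  (lambdaE : lambda = const_mx l) (muE : mu = const_mx l)
  (alphaE : alpha = const_mx a) (betaE : beta = const_mx a)
  (ordered : (E_plus theta /\ E_plus delta) \/ (D_plus theta /\ D_plus delta))
  (rhr_incr : forall v w : R, 0 < v -> v <= w ->
    v ^+ 2 * reversed_hazard_rate Fb fb v <=
    w ^+ 2 * reversed_hazard_rate Fb fb w) :
  weak_supermajorizes theta delta ->
  st_le (order_stat X n.-1) (order_stat Y n.-1).
Proof.
move=> major x.
rewrite !ccdf_1_cdf; apply: leeB => //.
have [_ theta0 _ X_cdf] := X_ELS; have [_ delta0 _ Y_cdf] := Y_ELS.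
subst lambda mu alpha beta.
(* At or below the location, every component exceeds [x] almost surely. *)
have [lx|xl] := ltP l x; last first.
  have X0 i : cdf (X i) x = 0%:E by rewrite X_cdf mxE ltNge xl.
  have Y0 i : cdf (Y i) x = 0%:E by rewrite Y_cdf mxE ltNge xl.
  by rewrite (cdf_second_largest hn X_indep X0) (cdf_second_largest hn Y_indep Y0).
pose u := x - l; have u0 : 0 < u by rewrite subr_gt0.
have F0 w : 0 < w -> 0 < Fb w.
  move=> w0; have [M M0 FM] := cumulative_eventually_gt0 Fb.
  exact: (cdf_gt0 Fb_fb rhr_incr w0 M0 FM).
have F1 t : 0 < t -> 0 <= Fb (u / t) by move=> t0; rewrite ltW// F0// divr_gt0.
have a0 := ltW a_gt0.
pose p t := Fb (u / t) `^ a.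
have p01 t : 0 < t -> 0 < p t <= 1.
  move=> t0; rewrite powR_gt0 ?F0 ?divr_gt0//=.
  rewrite -[leRHS](congr1 (@^~ a) (powR1 R)) ge0_ler_powR ?nnegrE ?F1//.
  exact: cumulative_le1.
have p_noninc s t : 0 < s -> s <= t -> p t <= p s.
  move=> s0 st; have t0 := lt_le_trans s0 st.
  rewrite ge0_ler_powR ?nnegrE ?F1//.
  by apply: (density_nondecreasing Fb_fb); rewrite ler_pM2l// lef_pV2.
have p_spread s t D : 0 <= D -> 0 < s - D -> s <= t ->
    p s * p t <= p (s - D) * p (t + D).
  move=> D0 sD st; have s0 : 0 < s by lra.
  have t0 : 0 < t by lra.
  have tD : 0 < t + D by lra.
  rewrite -!powRM ?F1// ge0_ler_powR ?nnegrE ?mulr_ge0 ?F1//.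
  have := @cdf_inv_spread _ _ _ Fb_fb rhr_incr F0 (s / u) (t / u) (D / u).
  rewrite -mulrBl -mulrDl !invf_div; apply.
  - by rewrite divr_ge0// ltW.
  - by rewrite divr_gt0.
  - by rewrite ler_pM2r// invr_gt0.
have X_p i : cdf (X i) x = (p (theta 0 i))%:E by rewrite X_cdf !mxE lx.
have Y_p i : cdf (Y i) x = (p (delta 0 i))%:E by rewrite Y_cdf !mxE lx.
have pgt0 t : 0 < t -> 0 < p t by move=> /p01/andP[].
rewrite (cdf_second_largest_gt0 hn X_indep (fun i => pgt0 _ (theta0 i)) X_p).
rewrite (cdf_second_largest_gt0 hn Y_indep (fun i => pgt0 _ (delta0 i)) Y_p).
rewrite lee_fin !at_most_one_failure_rearrangement.
apply: at_most_one_failure_weak_majorization => //.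
- by move=> i; exact: increasing_rearrangement_gt0.
- exact: increasing_rearrangement_incr.
- by move=> i; exact: increasing_rearrangement_gt0.
- by move=> m; exact: weak_supermajorizes_partial_sums.
Qed.
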